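(* Let $m$ and $F$ be positive integers with $F\geq 3$, $m\leq\frac{F+2}{2}$ and $m\nmid F$. The graph $G(\mathscr I(m,F))$, with vertex set $\mathscr I(m,F)$ and in which $(S,T)\in\mathscr I(m,F)\times\mathscr I(m,F)$ is an edge if and only if $S\prec T$, is a tree with root $C(m,F)$.
   Context: $\mathbb N$ denotes the non-negative integers. A numerical semigroup is a submonoid $S$ of $(\mathbb N,+)$ with $\mathbb N\setminus S$ finite. Its multiplicity $\operatorname{m}(S)$ is the smallest positive integer in $S$; its Frobenius number is the largest integer not in $S$. A numerical semigroup is irreducible if it cannot be expressed as the intersection of two numerical semigroups properly containing it. $\mathscr I(m,F)$ is the set of all irreducible numerical semigroups with multiplicity $m$ and Frobenius number $F$. The ratio $\operatorname{r}(S)$ is the smallest element of $S$ that is not a multiple of $\operatorname{m}(S)$. $C(m,F)$ denotes the unique element of $\mathscr I(m,F)$ with ratio greater than $F/2$ (it exists and is unique under the stated hypotheses on $m,F$). On $\mathscr I(m,F)$ define $T\preceq S$ if and only if $T=S$, or $\operatorname{r}(T)<F/2$ and $S=(T\setminus\{\operatorname{r}(T)\})\cup\{F-\operatorname{r}(T)\}$; write $T\prec S$ if $T\preceq S$ and $T\neq S$ (a one-step relation, not its transitive closure). A graph is a pair $(V,E)$ with $V$ a nonempty set of vertices and $E\subseteq\{(v,w)\in V\times V\mid v\neq w\}$ its (directed) edges. A path of length $n$ connecting $v$ and $w$ is a sequence of distinct edges $(v_0,v_1),(v_1,v_2),\ldots,(v_{n-1},v_n)$ with $v_0=v$, $v_n=w$.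 A graph is a tree with root $r$ if for every vertex $v\ne r$ there is a unique path connecting $v$ and $r$. *)

(* Defs.v *)
From mathcomp Require Import all_boot all_order.
From mathcomp Require Import boolp classical_sets cardinality.

Set Implicit Arguments.
Unset Strict Implicit.
Unset Printing Implicit Defensive.

Local Open Scope classical_set_scope.
Local Open Scope nat_scope.

(* The value is 0 when [A] is empty; for numerical semigroups this concerns only
   the ratio of the semigroup of all natural numbers. *)
Definition least (A : set nat) : nat :=
  xget 0 [set x | A x /\ lbound A x].

Definition numerical_semigroup (S : set nat) : Prop :=
  [/\ S 0, forall x y, S x -> S y -> S (x + y) & finite_set (~` S)].

Definition multiplicity (S : set nat) : nat :=
  least [set x | 0 < x /\ S x].

(* The only numerical semigroup whose Frobenius number is not a natural number
   is the set of all natural numbers, where it is -1; for that semigroup no [F]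
   satisfies this predicate. *)
Definition is_frobenius (S : set nat) (F : nat) : Prop :=
  (~` S) F /\ ubound (~` S) F.

Definition ratio (S : set nat) : nat :=
  least [set x | S x /\ ~~ (multiplicity S %| x)].

Definition irreducible_semigroup (S : set nat) : Prop :=
  numerical_semigroup S /\
  ~ exists T1 T2 : set nat,
      [/\ numerical_semigroup T1, numerical_semigroup T2,
          S `<` T1, S `<` T2 & S = T1 `&` T2].

Definition irreducibles (m F : nat) : set (set nat) :=
  [set S | [/\ irreducible_semigroup S, multiplicity S = m
             & is_frobenius S F]].

(* C(m,F). The value is the empty set, which is not a semigroup, when no
   element of [irreducibles m F] has ratio greater than F/2. *)
Definition Cmax (m F : nat) : set nat :=
  xget set0 [set S | irreducibles m F S /\ F < 2 * ratio S].

Definition preceq (F : nat) (T S : set nat) : Prop :=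
  T = S \/
  (2 * ratio T < F /\ S = (T `\ ratio T) `|` [set F - ratio T]).

Definition prec (F : nat) (T S : set nat) : Prop :=
  preceq F T S /\ T <> S.

Record digraph (T : Type) : Type := Digraph {
  vertices : set T;
  edges : set (T * T)
}.

Definition is_graph (T : Type) (G : digraph T) : Prop :=
  vertices G !=set0 /\
  edges G `<=` [set e | [/\ vertices G e.1, vertices G e.2 & e.1 <> e.2]].

(* With s = [:: v_1; ...; v_n] and v_0 = v, the list [zip (v :: s) s] is
   (v_0, v_1), ..., (v_(n-1), v_n). *)
Definition connecting_path (T : eqType) (G : digraph T) (v w : T)
    (p : seq (T * T)) : Prop :=
  exists s : seq T,
    [/\ p = zip (v :: s) s, last v s = w,
        forall e, e \in p -> edges G e & uniq p].

Definition tree_with_root (T : eqType) (G : digraph T) (r : T) : Prop :=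
  [/\ is_graph G, vertices G r
    & forall v, vertices G v -> v <> r ->
        exists! p : seq (T * T), connecting_path G v r p].

Definition irreducibles_graph (m F : nat) : digraph (set nat) :=
  Digraph (irreducibles m F)
    [set e | [/\ irreducibles m F e.1, irreducibles m F e.2
               & prec F e.1 e.2]].

(* Main.v *)
(** A numerical semigroup with Frobenius number [F] is irreducible iff every
    gap [x <> F/2] satisfies [F - x] in [S].  With this symmetry, replacing the
    ratio [r < F/2] by [F - r] gives again an element of I(m,F), of strictly
    larger ratio, and a semigroup with ratio greater than [F/2] is determined by
    [m] and [F].  Hence each vertex except C(m,F) has exactly one outgoing edge,
    C(m,F) has none, and following the edges must end in C(m,F). *)
Require Import Defs.
From mathcomp Require Import all_boot all_order.
From mathcomp Require Import boolp classical_sets cardinality.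
From mathcomp Require Import zify.

Set Implicit Arguments.
Unset Strict Implicit.
Unset Printing Implicit Defensive.

Local Open Scope classical_set_scope.
Local Open Scope nat_scope.

(** * Least elements of sets of natural numbers *)

Lemma leastP (A : set nat) : A !=set0 ->
  A (least A) /\ forall x, A x -> least A <= x.
Proof.
move=> [a Aa]; rewrite /least.
case: xgetP => [y _ [Ay lby]|noleast]; first by split.
have exA : exists n, `[< A n >] by exists a; apply/asboolP.
case: (ex_minnP exA) => n /asboolP An nmin; case: (noleast n); split=> //.
by move=> x Ax; apply: nmin; apply/asboolP.
Qed.

Lemma least_eq (A : set nat) a :
  A a -> (forall x, A x -> a <= x) -> least A = a.
Proof.
move=> Aa amin; have [|Al lmin] := @leastP A; first by exists a.
by apply/eqP; rewrite eqn_leq lmin // amin.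
Qed.

(** * Irreducibility as symmetry of the gaps *)

(** Covers both the symmetric ([F] odd) and the pseudo-symmetric ([F] even) semigroups; exempting
    [x * 2 = F] only matters in the latter case. *)
Record symmetric_semigroup (F : nat) (S : set nat) : Prop := SymmetricSemigroup {
  sym0 : S 0;
  symD : forall x y, S x -> S y -> S (x + y);
  symF : ~ S F;
  sym_gt : forall x, F < x -> S x;
  symB : forall x, x <= F -> x * 2 <> F -> ~ S x -> S (F - x)
}.

Lemma numerical_semigroupW (S : set nat) (F : nat) :
  S 0 -> (forall x y, S x -> S y -> S (x + y)) -> (forall x, F < x -> S x) ->
  numerical_semigroup S.
Proof.
move=> S0 SD Sgt; split=> //; apply: (@sub_finite_set _ _ `I_F.+1).
  by move=> x /= nSx; rewrite ltnS leqNgt; apply/negP => /Sgt.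
exact: finite_II.
Qed.

Lemma numerical_semigroup_setU1 (S : set nat) (h : nat) :
  numerical_semigroup S -> S (h + h) ->
  (forall s, 0 < s -> S s -> S (h + s)) ->
  numerical_semigroup (S `|` [set h]).
Proof.
move=> [S0 SD Sfin] Shh Shs; split; first by left.
- have hD s : S s -> (S `|` [set h]) (h + s).
    by case: s => [|s] Ss; [right; rewrite /= addn0|left; apply: Shs].
  move=> x y [Sx|->] [Sy|->]; last by left.
  + by left; apply: SD.
  + by rewrite addnC; apply: hD.
  + exact: hD.
- by apply: sub_finite_set Sfin => x nSx Sx; apply: nSx; left.
Qed.

(** If [T] were strictly larger, [S] would be the intersection of [T] with [S] enlarged by [F], two
    semigroups properly containing [S]. *)
Lemma irreducible_maximal (S T : set nat) (F : nat) :
  irreducible_semigroup S -> is_frobenius S F ->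
  numerical_semigroup T -> S `<=` T -> ~ T F -> T = S.
Proof.
move=> [Snum Sirr] [nSF Fub] Tnum ST nTF.
have Sgt x : F < x -> S x.
  move=> Fx; apply: contrapT => nSx; have := Fub x nSx.
  by rewrite /= leEnat leqNgt Fx.
have F0 : 0 < F.
  by rewrite lt0n; apply/eqP => F0; apply: nSF; rewrite F0; case: Snum.
apply: contrapT => TS; apply: Sirr; exists T, (S `|` [set F]); split=> //.
- by apply: numerical_semigroup_setU1 => // [|s s0 _]; apply: Sgt; lia.
- by split=> // TsubS; apply: TS; apply/seteqP.
- split=> [x Sx|US]; first by left.
  by apply: nSF; apply: US; right.
- apply/seteqP; split=> [x Sx|x [Tx [//|xF]]]; first by split; [exact: ST|left].
  by case: nTF; rewrite -xF.
Qed.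

(* The largest gap [h] violating the symmetry could be added to [S] without
   creating [F], contradicting maximality. *)
Lemma irreducible_symmetric (S : set nat) (F : nat) :
  irreducible_semigroup S -> is_frobenius S F -> symmetric_semigroup F S.
Proof.
move=> Sirr SF; have [[S0 SD Sfin] _] := Sirr; have [nSF Fub] := SF.
have Sgt x : F < x -> S x.
  move=> Fx; apply: contrapT => nSx; have := Fub x nSx.
  by rewrite /= leEnat leqNgt Fx.
split=> //.
pose bad x := `[< [/\ x <= F, x * 2 <> F, ~ S x & ~ S (F - x)] >].
move=> x0 x0F x0F2 nSx0; apply: contrapT => nSFx0.
have exbad : exists x, bad x by exists x0; apply/asboolP.
have badF x : bad x -> x <= F by move/asboolP => [].
case: (ex_maxnP exbad badF) => h /asboolP[hF hF2 nSh nSFh] hmax.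
(* The reflection [F - h] violates the symmetry too, so it is at most [h]. Hence [h + h] exceeds [F]
   and lies in [S]. *)
have hbig : F < h * 2.
  rewrite ltnNge; apply/negP => hle.
  have : F - h <= h.
    apply: hmax; apply/asboolP; split=> //; try lia.
    by rewrite subKn.
  lia.
have hneF : h <> F by move=> e; apply: nSFh; rewrite e subnn.
suff /seteqP[sub _] : S `|` [set h] = S by apply: nSh; apply: sub; right.
apply: (irreducible_maximal Sirr SF); last 2 first.
- by move=> x Sx; left.
- by move=> [//|/= e]; apply: hneF.
apply: numerical_semigroup_setU1; [by case: Sirr|by apply: Sgt; lia|].
move=> s s0 Ss; apply: contrapT => nShs.
have hsF : h + s <= F by rewrite leqNgt; apply/negP => /Sgt.
(* By maximality of [h], the gap [h + s] has its reflection in [S]; adding [s] to it puts [F - h] in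
   [S]. *)
have : ~ bad (h + s) by move/hmax; lia.
apply; apply/asboolP; split=> //; first lia.
move=> SFhs; apply: nSFh; have -> : F - h = F - (h + s) + s by lia.
exact: SD.
Qed.

Lemma symmetric_is_frobenius (S : set nat) (F : nat) :
  symmetric_semigroup F S -> is_frobenius S F.
Proof.
move=> Ssym; split; first exact: symF Ssym.
by move=> x nSx; rewrite leEnat leqNgt; apply/negP => /(sym_gt Ssym).
Qed.

(** Every semigroup properly containing [S] contains [F]: a new element [x] gives [F] as
    [x + (F - x)], or as [x + x] when [x] is half of [F]. So does any intersection of two of
    them. *)
Lemma symmetric_irreducible (S : set nat) (F : nat) :
  symmetric_semigroup F S -> irreducible_semigroup S.
Proof.
move=> [S0 SD nSF Sgt SB]; split; first exact: numerical_semigroupW Sgt.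
have withF T : numerical_semigroup T -> S `<` T -> T F.
  move=> [T0 TD _] [ST nTS]; apply: contrapT => nTF; apply: nTS => x Tx.
  apply: contrapT => nSx; apply: nTF.
  have xF : x <= F by rewrite leqNgt; apply/negP => /Sgt.
  have [<-|xF2] := eqVneq (x * 2) F; first by rewrite muln2 -addnn; apply: TD.
  rewrite -(subnKC xF); apply: TD => //; apply: ST.
  by apply: SB => //; apply/eqP.
by move=> [T1 [T2 [T1n T2n ST1 ST2 e]]]; apply: nSF; rewrite e; split; apply: withF.
Qed.

(** * Pointwise description of I(m,F) and of the ratio *)

Lemma irreduciblesP (m F : nat) (S : set nat) : 0 < m ->
  irreducibles m F S <->
  [/\ symmetric_semigroup F S, S m & forall x, 0 < x -> S x -> m <= x].
Proof.
move=> m0; split=> [[Sirr Sm SF]|[Ssym Sm mmin]].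
- have Ssym := irreducible_symmetric Sirr SF.
  have [|[_ Smul] minmul] := @leastP [set x | 0 < x /\ S x].
    by exists F.+1; split=> //; apply: sym_gt Ssym _ _.
  move: Smul minmul; rewrite -/(multiplicity S) Sm => Smul minmul.
  by split=> // x x0 Sx; apply: minmul.
- split; [exact: symmetric_irreducible Ssym| |exact: symmetric_is_frobenius].
  by apply: least_eq => // x [x0 Sx]; apply: mmin.
Qed.

Lemma ratioP (m F : nat) (S : set nat) : 1 < m -> irreducibles m F S ->
  [/\ S (ratio S), ~~ (m %| ratio S)
    & forall x, S x -> ~~ (m %| x) -> ratio S <= x].
Proof.
move=> m1 IS; have m0 := ltnW m1.
have [Ssym Sm _] := (irreduciblesP F S m0).1 IS; have [_ mulS _] := IS.
have [|[Sr nmr] rmin] := @leastP [set x | S x /\ ~~ (multiplicity S %| x)].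
  (* The witness exceeds [F] and is 1 modulo [m], where [1 < m]. *)
  exists (m * F.+1).+1; split; first by apply: (sym_gt Ssym); nia.
  by rewrite mulS -addn1 dvdn_addr ?dvdn_mulr // dvdn1; lia.
split=> //; first by move: nmr; rewrite -/(ratio S) mulS.
by move=> x Sx nmx; apply: rmin; split=> //; rewrite mulS.
Qed.

Lemma dvdn_mem (F m x : nat) (S : set nat) :
  symmetric_semigroup F S -> S m -> m %| x -> S x.
Proof.
move=> Ssym Sm /dvdnP[k ->]; elim: k => [|k IHk]; first exact: sym0 Ssym.
by rewrite mulSn; apply: symD Ssym _ _ Sm IHk.
Qed.

(** * Replacing the ratio by its reflection *)

(** The only possible target of an edge leaving [S]. *)
Definition swap_ratio (F : nat) (S : set nat) : set nat :=
  (S `\ ratio S) `|` [set F - ratio S].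

(** The ratio [r] is not a sum of two other elements, because elements below it are multiples of
    [m]; so it can be removed. Adjoining [F - r] is safe by symmetry: if [x + (F - r)] were a gap
    for some positive [x] in [S] other than [r], then [r - x] would lie in [S] and split [r]. *)
Lemma irreducibles_swap_ratio (m F : nat) (S : set nat) :
  1 < m -> 2 * m <= F + 2 -> irreducibles m F S -> 2 * ratio S < F ->
  irreducibles m F (swap_ratio F S).
Proof.
move=> m1 hmF IS; have m0 := ltnW m1.
have [Sr nmr rmin] := ratioP m1 IS.
have [[S0 SD nSF Sgt SB] Sm mmin] := (irreduciblesP F S m0).1 IS.
rewrite /swap_ratio; set r := ratio S in Sr nmr rmin * => rF.
have r0 : 0 < r by rewrite lt0n; apply: contraNneq nmr => ->; rewrite dvdn0.
have small x : S x -> x < r -> m %| x.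
  by move=> Sx xr; apply: contraLR xr => /(rmin _ Sx); rewrite -leqNgt.
have no_split x y : S x -> S y -> x <> r -> y <> r -> x + y <> r.
  move=> Sx Sy xr yr e; move/negP: nmr; apply; rewrite -e.
  have [xlt|xge] := ltnP x r; last lia.
  have [ylt|yge] := ltnP y r; last lia.
  by rewrite dvdn_add // small.
have DFr x : S x -> x <> r -> (S `\ r `|` [set F - r]) (x + (F - r)).
  move=> Sx xr; case: (posnP x) => [->|x0]; first by right.
  left; split; last by rewrite /=; lia.
  apply: contrapT => nS.
  have xr' : x + (F - r) <= F by rewrite leqNgt; apply/negP => /Sgt.
  have Srx : S (r - x).
    by rewrite (_ : r - x = F - (x + (F - r))); [apply: SB => //; lia|lia].
  by case: (@no_split x (r - x)) => //; lia.
apply/(irreduciblesP F _ m0); split.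
- split.
  + by left; split=> //=; lia.
  + move=> x y [[Sx /= xr]|->] [[Sy /= yr]|->].
    * by left; split; [exact: SD|exact: no_split].
    * exact: DFr.
    * by rewrite addnC; apply: DFr.
    * by left; split; [apply: Sgt; lia|rewrite /=; lia].
  + by move=> [[]//|/=]; lia.
  + by move=> x xF; left; split; [exact: Sgt|rewrite /=; lia].
  + move=> x xF xF2 nx; have [->|/eqP xr] := eqVneq x r; first by right.
    have nSx : ~ S x by move=> Sx; apply: nx; left.
    have xFr : x <> F - r by move=> e; apply: nx; right.
    by left; split; [exact: SB|rewrite /=; lia].
- by left; split=> //= e; rewrite e dvdnn in nmr.
(* The new element is at least [m]: [2 * (F - r) >= F + 1 >= 2 * m - 1]. *)
- move=> x x0 [[Sx _]|/= ->]; [exact: mmin|lia].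
Qed.

(** The new ratio is either [F - ratio S], which is larger, or a non-multiple of [m] in [S] other
    than [ratio S], hence larger by minimality. *)
Lemma ratio_swap_ratio (m F : nat) (S : set nat) :
  1 < m -> 2 * m <= F + 2 -> irreducibles m F S -> 2 * ratio S < F ->
  ratio S < ratio (swap_ratio F S).
Proof.
move=> m1 hmF IS rF; have IS' := irreducibles_swap_ratio m1 hmF IS rF.
have [_ _ rmin] := ratioP m1 IS.
have [[[Sr' rr']|/= ->] nmr' _] := ratioP m1 IS'; last by lia.
by rewrite ltn_neqAle rmin // andbT; apply/eqP => e; apply: rr'; rewrite /= -e.
Qed.

(** * The semigroup with ratio above F/2 *)

Lemma double_ratio_neq (m F : nat) (S : set nat) :
  1 < m -> irreducibles m F S -> 2 * ratio S <> F.
Proof.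
move=> m1 IS e; have [Sr _ _] := ratioP m1 IS.
have [[_ SD nSF _ _] _ _] := (irreduciblesP F S (ltnW m1)).1 IS.
by apply: nSF; rewrite -e mul2n -addnn; apply: SD.
Qed.

Lemma irreducibles_large_ratio_exists (m F : nat) :
  1 < m -> 2 * m <= F + 2 -> ~~ (m %| F) ->
  exists S, irreducibles m F S /\ F < 2 * ratio S.
Proof.
move=> m1 hmF hdiv; have m0 := ltnW m1.
(* Below F/2 only multiples of [m] are allowed; symmetry then dictates the elements between F/2 and
   [F]. At [x = F] the difference is 0, so the last clause leaves [F] out. *)
pose C := [set x | m %| x \/ F < x \/ F < 2 * x /\ ~~ (m %| F - x)].
have CDl x y : m %| x -> C y -> C (x + y).
  move=> mx [my|[Fy|[Fy nmy]]]; first by left; rewrite /= dvdn_add.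
  - by right; left; lia.
  - right; have [|xyF] := ltnP F (x + y); [by left|right; split; first lia].
    by apply: contra nmy; rewrite (_ : F - y = F - (x + y) + x); [move/dvdn_add->|lia].
have IC : irreducibles m F C.
  apply/(irreduciblesP F _ m0); split.
  - split.
    + by left.
    + move=> x y Cx Cy; case: (Cx) => [mx|Cx']; first exact: CDl.
      case: (Cy) => [my|Cy']; first by rewrite addnC; apply: CDl.
      (* Two elements of [C] that are not covered by the first clause both exceed F/2, so their sum
         exceeds [F]. *)
      by right; left; lia.
    + by case=> [mF|[|[_]]]; [rewrite mF in hdiv|rewrite ltnn|rewrite subnn dvdn0].
    + by move=> x Fx; right; left.
    + move=> x xF xF2 nCx; have [mFx|nmFx] := boolP (m %| F - x); first by left.
      right; right; split.
        by rewrite ltnNge; apply/negP => h; apply: nCx; right; right; split=> //; lia.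
      by rewrite subKn //; apply/negP => mx; apply: nCx; left.
  - by left => /=.
  - move=> x x0 [mx|Cx]; [exact: dvdn_leq|lia].
exists C; split=> //; have [Cr nmr _] := ratioP m1 IC.
by case: Cr => [mr|]; [rewrite mr in nmr|lia].
Qed.

(** The right-hand side does not mention [S], whence uniqueness. Below the ratio, [S] consists of
    the multiples of [m], so for [x] between F/2 and [F] divisibility of [F - x] decides whether
    [F - x], and by symmetry [x], lies in [S]. *)
Lemma irreducibles_large_ratio_mem (m F : nat) (S : set nat) (x : nat) :
  1 < m -> irreducibles m F S -> F < 2 * ratio S ->
  S x <-> m %| x \/ F < x \/ F < 2 * x /\ ~~ (m %| F - x).
Proof.
move=> m1 IS rF; have [_ _ rmin] := ratioP m1 IS.
have [Ssym Sm _] := (irreduciblesP F S (ltnW m1)).1 IS.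
have [_ SD nSF Sgt SB] := Ssym.
split=> [Sx|[mx|[Fx|[Fx nmx]]]]; last 3 first.
- exact: dvdn_mem Ssym Sm mx.
- exact: Sgt.
- have [/Sgt //|xF] := ltnP F x.
  rewrite -(subKn xF); apply: SB; [lia|lia|].
  by move=> SFx; have := rmin _ SFx nmx; lia.
- have [mx|nmx] := boolP (m %| x); first by left.
  have rx := rmin _ Sx nmx; right; have [|xF] := ltnP F x; first by left.
  right; split; first lia.
  apply/negP => mFx; apply: nSF; rewrite -(subnK xF).
  by apply: SD => //; apply: dvdn_mem Ssym Sm mFx.
Qed.

Lemma irreducibles_large_ratio_unique (m F : nat) (S T : set nat) :
  1 < m -> irreducibles m F S -> F < 2 * ratio S ->
  irreducibles m F T -> F < 2 * ratio T -> S = T.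
Proof.
move=> m1 IS rS IT rT; apply/seteqP; split=> x.
- by move/(irreducibles_large_ratio_mem x m1 IS rS)
    /(irreducibles_large_ratio_mem x m1 IT rT).
- by move/(irreducibles_large_ratio_mem x m1 IT rT)
    /(irreducibles_large_ratio_mem x m1 IS rS).
Qed.

Lemma CmaxP (m F : nat) : 1 < m -> 2 * m <= F + 2 -> ~~ (m %| F) ->
  irreducibles m F (Cmax m F) /\ F < 2 * ratio (Cmax m F).
Proof.
move=> m1 hmF hdiv; rewrite /Cmax; case: xgetP => [//|none].
by have [S] := irreducibles_large_ratio_exists m1 hmF hdiv => /none.
Qed.

(** * Rooted trees from ranked functional graphs *)

(** Following the unique outgoing edges lowers [rank], so the walk stops, and it can only stop at
    [r]. *)
Lemma functional_graph_tree (T : eqType) (G : digraph T) (r : T)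
    (rank : T -> nat) :
  vertices G r ->
  (forall v w, edges G (v, w) -> vertices G v /\ vertices G w) ->
  (forall v w, edges G (v, w) -> rank w < rank v) ->
  (forall v w w', edges G (v, w) -> edges G (v, w') -> w = w') ->
  (forall w, ~ edges G (r, w)) ->
  (forall v, vertices G v -> v <> r -> exists w, edges G (v, w)) ->
  tree_with_root G r.
Proof.
move=> Gr Gedge rank_lt fun_edge r_sink out_edge; split=> //.
  split; first by exists r.
  case=> v w /= Evw; have [Gv Gw] := Gedge _ _ Evw; split=> //= vw.
  by have := rank_lt _ _ Evw; rewrite vw ltnn.
(* The last conjunct bounds the ranks of the edge sources; it shows that a first edge out of a
   vertex of higher rank does not recur later, so edges stay distinct. *)
have exists_path n v : rank v <= n -> vertices G v -> exists s : seq T,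
    [/\ last v s = r, forall e, e \in zip (v :: s) s -> edges G e,
        uniq (zip (v :: s) s)
      & forall e, e \in zip (v :: s) s -> rank e.1 <= rank v].
  elim: n v => [|n IHn] v rv Gv; have [->|/eqP vr] := eqVneq v r;
    try by exists [::].
    by have [w /rank_lt] := out_edge v Gv vr; rewrite ltnNge (leq_trans rv).
  have [w Evw] := out_edge v Gv vr.
  have rw := rank_lt _ _ Evw; have [_ Gw] := Gedge _ _ Evw.
  have [|s [lst Es us rs]] := IHn w _ Gw; first by rewrite -ltnS (leq_trans rw).
  exists (w :: s); split=> //.
  - by move=> e; rewrite inE => /orP[/eqP->|/Es].
  - apply/andP; split=> //; apply/negP => /rs /=.
    by rewrite leqNgt rw.
  - move=> e; rewrite inE => /orP[/eqP-> //|/rs es].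
    exact: leq_trans es (ltnW rw).
(* Both walks take the same edge at each vertex, and neither can continue past [r], which has no
   outgoing edge. *)
have unique_path s s' v : last v s = r -> last v s' = r ->
    (forall e, e \in zip (v :: s) s -> edges G e) ->
    (forall e, e \in zip (v :: s') s' -> edges G e) -> s = s'.
  elim: s s' v => [|w s IHs] [|w' s'] v //=.
  - by move=> -> _ _ E; case: (r_sink w'); apply: E; rewrite mem_head.
  - by move=> _ -> E _; case: (r_sink w); apply: E; rewrite mem_head.
  - move=> ls ls' E E'.
    have ww' : w = w'.
      by apply: (fun_edge v); [apply: E|apply: E']; rewrite mem_head.
    rewrite -ww' in ls' E' *; congr cons; apply: IHs ls ls' _ _ => e es.
      by apply: E; rewrite inE es orbT.
    by apply: E'; rewrite inE es orbT.
move=> v Gv _; have [s [ls Es us _]] := exists_path _ v (leqnn _) Gv.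
exists (zip (v :: s) s); split; first by exists s.
move=> _ [s' [-> ls' Es' _]].
by rewrite (unique_path s s' v).
Qed.

Theorem corollary23 (m F : nat) (hm : (0 < m)%N) (hF : (3 <= F)%N)
    (hmF : (2 * m <= F + 2)%N) (hdiv : ~~ (m %| F)%N) :
  tree_with_root (irreducibles_graph m F) (Cmax m F).
Proof.
have m1 : 1 < m by case: m hm hdiv {hmF} => [|[|]] //; rewrite dvd1n.
have [IC rC] := CmaxP m1 hmF hdiv.
have precE S T : prec F S T -> 2 * ratio S < F /\ T = swap_ratio F S.
  by move=> [[]].
(* Despite truncated subtraction this rank strictly decreases along edges, since the source of an
   edge has ratio below F/2. *)
apply: (@functional_graph_tree _ _ _ (fun S => F - ratio S)) => //.
- by move=> S T [].
- move=> S T [/= IS _ /precE[rF ->]].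
  by have := ratio_swap_ratio m1 hmF IS rF; lia.
- by move=> S T T' [_ _ /precE[_ /= ->]] [_ _ /precE[_ /= ->]].
- by move=> T [_ _ /precE[/=]]; lia.
(* Twice the ratio is never [F], and ratio above F/2 would force [S] to be [Cmax m F]. *)
- move=> S IS SC; have rF : 2 * ratio S < F.
    have rF2 := double_ratio_neq m1 IS.
    have [//|rF] := ltnP (2 * ratio S) F; case: SC.
    by apply: irreducibles_large_ratio_unique m1 IS _ IC rC; lia.
  exists (swap_ratio F S); split=> //=; first exact: irreducibles_swap_ratio.
  split; first by right.
  by move=> e; have := ratio_swap_ratio m1 hmF IS rF; rewrite -e ltnn.
Qed.
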